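(* Let $n=1$, $\Omega=(0,3)$, $\mu=\chi_{(1,2)}$, $c=\chi_{(2,3)}$, $h=0$, and consider for $\lambda\in\mathbb{R}$ the problem $-u''=\mu(x)|u'|^2+\lambda c(x)u$ in $(0,3)$, $u\in H^1_0(0,3)\cap L^\infty(0,3)$ (in the weak sense with test functions in $H^1_0(0,3)\cap L^\infty(0,3)$). There exist a sequence $\lambda_j\to\pi^2/4$ and a sequence $u_j\in H^2(0,3)\cap H^1_0(0,3)$ such that each $u_j$ is a solution of this problem with $\lambda=\lambda_j$ and $\|u_j\|_\infty\to\infty$ as $j\to\infty$.
   Context: $\chi_A$ denotes the indicator function of the set $A$. *)

(* Defs.v *)
From HB Require Import structures.
From mathcomp Require Import all_boot all_order all_algebra.
From mathcomp Require Import all_classical all_reals all_analysis.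
From mathcomp Require Import ess_sup_inf.
Set Implicit Arguments. Unset Strict Implicit. Unset Printing Implicit Defensive.
Import Order.TTheory GRing.Theory Num.Theory numFieldNormedType.Exports.
Local Open Scope classical_set_scope.
Local Open Scope ring_scope.

Section Defs.
Context {R : realType}.
Local Notation mu := (@lebesgue_measure R).

Definition Om : set R := `]0, 3[.

Definition test_fun (phi : R -> R) : Prop :=
  (forall (n : nat) (x : R), derivable (derive1n n phi) x 1) /\
  exists a b : R, 0 < a /\ b < 3 /\ forall x, x < a \/ b < x -> phi x = 0.

Definition inL2 (f : R -> R) : Prop :=
  measurable_fun Om f /\ (\int[mu]_(x in Om) ((f x ^+ 2)%:E) < +oo)%E.

Definition inLinf (f : R -> R) : Prop :=
  measurable_fun Om f /\ exists M : R, \forall x \ae mu, Om x -> `|f x| <= M.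

Definition Linf_norm (f : R -> R) : \bar R :=
  ess_sup mu (fun x => (\1_Om x * `|f x|)%:E).

Definition weak_deriv (u g : R -> R) : Prop :=
  forall phi, test_fun phi ->
    Rintegral mu Om (fun x => u x * derive1 phi x) = - Rintegral mu Om (fun x => g x * phi x).

Definition inH1 (u : R -> R) : Prop :=
  inL2 u /\ exists g, inL2 g /\ weak_deriv u g.

Definition inH10 (u : R -> R) : Prop :=
  inH1 u /\ exists g, inL2 g /\ weak_deriv u g /\
    exists phis : nat -> R -> R, (forall k, test_fun (phis k)) /\
      ((fun k : nat => (\int[mu]_(x in Om) (((phis k x - u x) ^+ 2)%:E))%E)
         @ \oo --> 0%E) /\
      ((fun k : nat => (\int[mu]_(x in Om) (((derive1 (phis k) x - g x) ^+ 2)%:E))%E)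
         @ \oo --> 0%E).

Definition inH2 (u : R -> R) : Prop :=
  inL2 u /\ exists g, inL2 g /\ weak_deriv u g /\ inH1 g.

Definition is_solution (lam : R) (u : R -> R) : Prop :=
  inH10 u /\ inLinf u /\
  exists g, inL2 g /\ weak_deriv u g /\
    forall phi psi, inH10 phi -> inLinf phi -> inL2 psi -> weak_deriv phi psi ->
      Rintegral mu Om (fun x => g x * psi x) =
        Rintegral mu Om (fun x => \1_(`]1, 2[ : set R) x * `|g x| ^+ 2 * phi x)
        + lam * Rintegral mu Om (fun x => \1_(`]2, 3[ : set R) x * u x * phi x).

End Defs.

(* Main.v *)
(** On each unit interval the equation is explicit: [u = s x] on (0,1),
    [u = s + ln (1 + s (x - 1))] on (1,2), where [v = u'] solves [v' = - v^2],
    and [u = A sin (om (3 - x))] on (2,3) with [lam = om^2].  The pieces match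
    to first order at 2 iff
      [- om cot om = s / ((1 + s) (s + ln (1 + s)))].
    The right-hand side is at most [1 / s], so the intermediate value theorem
    yields, for [s] large, a root [om] as close to [pi / 2] from above as one
    wishes, while [u] has size [s].

    Membership in [H^1_0] asks for test functions approximating [u].  Linear
    combinations of the bumps built from [exp (- 1 / x)] approximate the
    continuous function [u'] in [L^2]; after a correction making their
    integrals vanish, their primitives are test functions approximating [u] in
    [H^1].  The same density shows that any two weak derivatives of a function
    have the same integral against [u'], which is what testing the equation
    against arbitrary elements of [H^1_0] requires. *)
Require Import Defs.
From HB Require Import structures.
From mathcomp Require Import all_boot all_order all_algebra.
From mathcomp Require Import all_classical all_reals all_analysis.
From mathcomp Require Import measurable_realfun ess_sup_inf ring lra.
Import Order.TTheory GRing.Theory Num.Theory numFieldNormedType.Exports.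
Local Open Scope classical_set_scope.
Local Open Scope ring_scope.
Set Implicit Arguments.
Unset Strict Implicit.
Unset Printing Implicit Defensive.

(** * Smooth functions on the line and the flat functions built from exp (- 1 / x) *)

Section SmoothFunctions.
Context {R : realType}.
Implicit Types (f g : R -> R) (P : {poly R}) (x d : R).

Definition smooth f := forall (n : nat) (x : R), derivable (derive1n n f) x 1.

Lemma derivable_is_derive1 f x :
  derivable f x 1 -> is_derive x 1 f (derive1 f x).
Proof. by move=> df; rewrite derive1E; exact: derivableP. Qed.

Lemma is_derive_derive1 f x d : is_derive x 1 f d -> derive1 f x = d.
Proof. by move=> df; rewrite derive1E derive_val. Qed.

Lemma is_derive_continuous f x d : is_derive x 1 f d -> {for x, continuous f}.
Proof.
by case=> df _; apply/differentiable_continuous/derivable1_diffP.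
Qed.

Lemma smooth_is_derive f x : smooth f -> is_derive x 1 f (derive1 f x).
Proof. by move=> /(_ 0%N x); exact: derivable_is_derive1. Qed.

Lemma smooth_derive1 f : smooth f -> smooth (derive1 f).
Proof. by move=> sf n x; rewrite -derive1Sn; exact: sf. Qed.

Lemma smooth_continuous f : smooth f -> continuous f.
Proof. by move=> sf x; apply: is_derive_continuous (smooth_is_derive x sf). Qed.

(** Since the derivative stays in [S], induction on the order of differentiation applies. Proving
    smoothness thus reduces to exhibiting a class of functions closed under differentiation. *)
Lemma smooth_closed (S : set (R -> R)) :
  (forall f, S f -> exists2 g, S g & forall x, is_derive x 1 f (g x)) ->
  forall f, S f -> smooth f.
Proof.
move=> dS f Sf n; elim: n f Sf => [|n IH] f /dS[g Sg fg] x.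
  by case: (fg x).
have fE : derive1 f = g by apply/funext => y; exact: is_derive_derive1.
by rewrite derive1Sn fE; exact: IH.
Qed.

Lemma smooth_antiderivative f g :
  (forall x, is_derive x 1 f (g x)) -> smooth g -> smooth f.
Proof.
move=> fg sg; apply: (@smooth_closed [set h | h = f \/ smooth h]); last by left.
move=> h [->|sh]; first by exists g; [right|].
exists (derive1 h); first by right; exact: smooth_derive1.
by move=> x; exact: smooth_is_derive.
Qed.

Lemma smooth_cst (c : R) : smooth (cst c).
Proof.
apply: (@smooth_closed (range (fun c : R => cst c))); last by exists c.
by move=> _ [d _ <-]; exists (cst 0); [exists 0|move=> x; exact: is_derive_cst].
Qed.

Lemma smoothD f g : smooth f -> smooth g -> smooth (f \+ g).
Proof.
move=> sf sg.
apply: (@smooth_closed [set h | exists p q, [/\ smooth p, smooth q & h = p \+ q]]).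
  move=> _ [p [q [sp sq ->]]].
  exists (derive1 p \+ derive1 q).
    by exists (derive1 p), (derive1 q); split => //; exact: smooth_derive1.
  by move=> x; apply: is_deriveD; exact: smooth_is_derive.
by exists f, g.
Qed.

(** The derivative of a product is a sum of products, so products alone do not form a class closed
    under differentiation. The induction runs instead on a finite order of differentiability [C n],
    sums being treated first: the two products in the Leibniz rule have factors in [C n] when the
    original ones are in [C n.+1]. *)
Lemma smoothM f g : smooth f -> smooth g -> smooth (f \* g).
Proof.
pose C n f := forall m, (m <= n)%N -> forall x, derivable (derive1n m f) x 1.
have CS n h : C n.+1 h -> C n (derive1 h).
  by move=> Ch m mn x; rewrite -derive1Sn; exact: Ch.
have CW n h : C n.+1 h -> C n h by move=> Ch m mn; apply: Ch; exact: ltnW.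
have CD n : forall p q, C n p -> C n q -> C n (p \+ q).
  elim: n => [|n IH] p q Cp Cq [|m] // mn x.
  - by apply: derivableD; [exact: (Cp 0%N)|exact: (Cq 0%N)].
  - by apply: derivableD; [exact: (Cp 0%N)|exact: (Cq 0%N)].
  rewrite derive1Sn (_ : derive1 _ = derive1 p \+ derive1 q); last first.
    apply/funext => y; apply: is_derive_derive1.
    by apply: is_deriveD; apply: derivable_is_derive1;
      [exact: (Cp 0%N)|exact: (Cq 0%N)].
  by apply: IH => //; exact: CS.
suff CM n : forall p q, C n p -> C n q -> C n (p \* q).
  by move=> sf sg n; apply: (CM n) (leqnn n) => m _; [exact: sf|exact: sg].
elim: n => [|n IH] p q Cp Cq [|m] // mn x.
- by apply: derivableM; [exact: (Cp 0%N)|exact: (Cq 0%N)].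
- by apply: derivableM; [exact: (Cp 0%N)|exact: (Cq 0%N)].
rewrite derive1Sn (_ : derive1 _ = (p \* derive1 q) \+ (q \* derive1 p));
  last first.
  apply/funext => y; apply: is_derive_derive1.
  by apply: is_deriveM; apply: derivable_is_derive1;
    [exact: (Cp 0%N)|exact: (Cq 0%N)].
by apply: (CD n) (mn) x; apply: IH; by [exact: CW|exact: CS].
Qed.

Lemma smoothZ (c : R) f : smooth f -> smooth (fun x => c * f x).
Proof. by move=> sf; apply: (@smoothM (cst c) f) => //; exact: smooth_cst. Qed.

Lemma is_derive_affine (a b x : R) : is_derive x 1 (fun x => a * x + b) a.
Proof.
have -> : (fun x => a * x + b) = (a \*: id) + cst b by [].
by apply: is_derive_eq; rewrite addr0 /GRing.scale /= mulr1.
Qed.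

Lemma is_derive_comp_affine f (a b x d : R) : is_derive (a * x + b) 1 f d ->
  is_derive x 1 (fun x => f (a * x + b)) (a * d).
Proof.
move=> df; rewrite mulrC.
exact: (@is_derive1_comp R f (fun x => a * x + b) x d a df
          (is_derive_affine a b x)).
Qed.

Lemma smooth_comp_affine f (a b : R) :
  smooth f -> smooth (fun x => f (a * x + b)).
Proof.
(* The constant [c] absorbs the factor [a] that each differentiation brings out. *)
move=> sf; apply: (@smooth_closed
  [set h | exists c p, smooth p /\ h = fun x => c * p (a * x + b)]).
  move=> _ [c [p [sp ->]]].
  exists (fun x => c * a * derive1 p (a * x + b)).
    by exists (c * a), (derive1 p); split => //; exact: smooth_derive1.
  move=> x; rewrite -mulrA.
  by apply: is_deriveZ; apply: is_derive_comp_affine; exact: smooth_is_derive.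
by exists 1, f; split => //; apply/funext => x; rewrite mul1r.
Qed.

(** The polynomial in 1 / x accounts for the factors that differentiating exp (- 1 / x) brings out;
    [flat 1] is the classical smooth function that is flat at 0. *)
Definition flat P (x : R) := if 0 < x then P.[x^-1] * expR (- x^-1) else 0.

(** Each monomial obeys y^i <= i! exp y by the exponential series, which explains the constant. With
    y = 1 / x it controls the flat functions near 0. *)
Lemma horner_expRN_bounded P :
  exists2 C, 0 <= C & forall y, 0 < y -> `|P.[y] * expR (- y)| <= C.
Proof.
exists (\sum_(i < size P) `|P`_i| * i`!%:R).
  by apply: sumr_ge0 => i _; rewrite mulr_ge0.
move=> y y0; rewrite horner_coef mulr_suml.
apply: le_trans (ler_norm_sum _ _ _) _; apply: ler_sum => i _.
rewrite -mulrA normrM ler_wpM2l// ger0_norm; last first.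
  by rewrite mulr_ge0 ?expR_ge0 ?exprn_ge0 ?ltW.
rewrite expRN ler_pdivrMr ?expR_gt0// mulrC -ler_pdivrMr ?ltr0n ?fact_gt0//.
case: (nat_of_ord i) => [|n].
  by rewrite expr0 fact0 invr1 mulr1 -expR0 ler_expR ltW.
by apply: le_trans (expR_ge1Dxn n (ltW y0)); rewrite lerDr.
Qed.

Lemma is_derive0_quadratic f (C : R) :
  (forall x, `|f x| <= C * x ^+ 2) -> is_derive (0 : R) 1 f 0.
Proof.
move=> fC; have f0 : f 0 = 0.
  by apply/eqP; rewrite -normr_le0 (le_trans (fC 0))// expr0n mulr0.
have C0 : 0 <= C by have := fC 1; rewrite expr1n mulr1; exact: le_trans.
have cvg0 : (fun h => h^-1 *: (f (h *: 1 + 0) - f 0)) @ (0 : R)^' --> (0 : R).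
  apply/cvgr0Pnorm_le => e e0.
  (* The difference quotient at [h] is at most C |h|; [C + 1] keeps the threshold meaningful when
     [C] is 0. *)
  have d0 : 0 < e / (C + 1) by rewrite divr_gt0// ltr_wpDl.
  near=> h; rewrite f0 subr0 addr0 [_ *: 1]mulr1 normrM.
  have h0 : h != 0 by near: h; exact: nbhs_dnbhs_neq.
  rewrite normfV ler_pdivrMl ?normr_gt0// (le_trans (fC h))//.
  rewrite -real_normK ?num_real// expr2 mulrA [leRHS]mulrC.
  rewrite ler_wpM2r//.
  have he : `|h| <= e / (C + 1).
    by near: h; exact: dnbhs0_le.
  apply: le_trans (ler_wpM2l C0 he) _.
  by rewrite mulrA ler_pdivrMr ?ltr_wpDl// mulrDr mulr1 mulrC lerDl ltW.
apply: DeriveDef; first by apply/cvg_ex; exists 0.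
exact: cvg_lim cvg0.
Unshelve. all: by end_near. Qed.

(* The functions [flat P] are closed under differentiation, whence smoothness. *)
Lemma is_derive_flat P x :
  is_derive x 1 (flat P) (flat ('X ^+ 2 * (P - P^`()))  x).
Proof.
have [x0|x0|->] := ltgtP x 0.
- rewrite [X in is_derive _ _ _ X](_ : _ = 0); last by rewrite /flat ltNge ltW.
  apply: (@near_eq_is_derive _ _ _ (cst 0)).
  near=> y; rewrite /flat ltNge ltW//.
  by near: y; exact: lt_nbhsl.
- suff : is_derive x 1 (fun y => P.[y^-1] * expR (- y^-1))
      (flat ('X ^+ 2 * (P - P^`())) x).
    apply: near_eq_is_derive; near=> y; rewrite /flat ifT//.
    by near: y; exact: lt_nbhsr.
  have dV : is_derive x 1 (fun y : R => y^-1) (- x ^- 2).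
    apply: is_derive_eq; first by apply: is_deriveV; rewrite gt_eqF.
    by rewrite [_ *: 1]mulr1.
  have dNV : is_derive x 1 (fun y : R => - y^-1) (x ^- 2).
    by apply: is_derive_eq; rewrite opprK.
  have d1 : is_derive x 1 (fun y => P.[y^-1]) (P^`().[x^-1] * - x ^- 2).
    exact: (@is_derive1_comp _ (horner P) (fun y : R => y^-1)).
  have d2 : is_derive x 1 (fun y => expR (- y^-1)) (expR (- x^-1) * x ^- 2).
    exact: (@is_derive1_comp _ expR (fun y : R => - y^-1)).
  apply: (is_derive_eq (is_deriveM d1 d2)).
  rewrite /flat x0 !hornerE /GRing.scale/= -exprVn; ring.
- rewrite [X in is_derive _ _ _ X](_ : _ = 0); last by rewrite /flat ltxx.
  (* Bounding X^2 P rather than P at 1 / h yields the factor h^2 of a quadratic majorant. *)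
  have [C C0 HC] := horner_expRN_bounded ('X ^+ 2 * P).
  apply: (@is_derive0_quadratic _ C) => h; rewrite /flat.
  case: ifPn => [h0|_]; last by rewrite normr0 mulr_ge0// sqr_ge0.
  rewrite -ler_pdivrMr ?exprn_gt0//.
  have hV : 0 < h^-1 by rewrite invr_gt0.
  apply: le_trans (HC _ hV); rewrite hornerM hornerXn -[in leRHS]mulrA.
  by rewrite [in leRHS]normrM (ger0_norm (sqr_ge0 _)) exprVn mulrC.
Unshelve. all: by end_near. Qed.

Lemma smooth_flat P : smooth (flat P).
Proof.
apply: (@smooth_closed (range flat)); last by exists P.
move=> _ [Q _ <-]; exists (flat ('X ^+ 2 * (Q - Q^`()))); first by eexists.
by move=> x; exact: is_derive_flat.
Qed.

End SmoothFunctions.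

(** * Square-integrable functions on (0, 3) *)

Section SquareIntegrable.
Context {R : realType}.
Implicit Types (f g h : R -> R) (c M : R).
Local Notation mu := (@lebesgue_measure R).
Local Notation Om := (@Om R).
Local Notation integrable f := (mu.-integrable Om (EFin \o f)).

Lemma norm_mulr_le_sqr (a b : R) : `|a * b| <= a ^+ 2 + b ^+ 2.
Proof.
have := sqr_ge0 (a + b); rewrite sqrrD; have := sqr_ge0 (a - b); rewrite sqrrB.
have := sqr_ge0 a; have := sqr_ge0 b; rewrite ler_norml => *.
by apply/andP; split; lra.
Qed.

Lemma sqrD_le (a b : R) : (a + b) ^+ 2 <= 2 * a ^+ 2 + 2 * b ^+ 2.
Proof. by have := sqr_ge0 (a - b); rewrite sqrrB sqrrD => *; lra. Qed.

(** The norm stays squared, so no square root appears: [sqnormD_le] stands in for the triangle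
    inequality and [norm_RintegralM_le] for Cauchy-Schwarz. *)
Definition sqnorm f : R := \int[mu]_(x in Om) (f x ^+ 2).

Lemma measurable_Om : measurable Om. Proof. exact: measurable_itv. Qed.
Hint Resolve measurable_Om : core.

Lemma mu_Om : mu Om = 3%:E.
Proof. by rewrite /Om lebesgue_measure_itv/= lte_fin ltr0n oppr0 adde0. Qed.

Lemma inL2_integrable_sqr f : inL2 f -> integrable (fun x => f x ^+ 2).
Proof.
move=> [mf f2]; apply/integrableP; split.
  by apply/measurable_EFinP; exact: measurable_funX.
by under eq_integral do rewrite /= ger0_norm ?sqr_ge0//.
Qed.

Lemma inL2P f :
  measurable_fun Om f -> integrable (fun x => f x ^+ 2) -> inL2 f.
Proof.
move=> mf /integrableP[_ f2]; split=> //; move: f2.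
by under eq_integral do rewrite /= ger0_norm ?sqr_ge0//.
Qed.

Lemma EFin_sqnorm f : inL2 f ->
  (sqnorm f)%:E = (\int[mu]_(x in Om) ((f x ^+ 2)%:E))%E.
Proof.
move=> /inL2_integrable_sqr f2; rewrite fineK//.
exact: integrable_fin_num f2.
Qed.

Lemma sqnorm_ge0 f : 0 <= sqnorm f.
Proof. by apply: Rintegral_ge0 => x _; exact: sqr_ge0. Qed.

Lemma le_integrable_Om f g : measurable_fun Om f ->
  (forall x, Om x -> `|f x| <= g x) -> integrable g -> integrable f.
Proof.
move=> mf fg; apply: le_integrable => //; first exact/measurable_EFinP.
by move=> x Ox /=; rewrite lee_fin (le_trans (fg _ Ox))// ler_norm.
Qed.

Lemma integrableD_Om f g : integrable f -> integrable g ->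
  integrable (fun x => f x + g x).
Proof. by move=> If Ig; exact: integrableD If Ig. Qed.

Lemma integrableZ_Om c f : integrable f -> integrable (fun x => c * f x).
Proof. by move=> If; exact: integrableZl If. Qed.

Lemma inL2M f g : inL2 f -> inL2 g -> integrable (fun x => f x * g x).
Proof.
move=> Lf Lg; have [mf _] := Lf; have [mg _] := Lg.
apply: (@le_integrable_Om _ (fun x => f x ^+ 2 + g x ^+ 2)).
- exact: measurable_funM.
- by move=> x _; exact: norm_mulr_le_sqr.
- by apply: integrableD_Om; exact: inL2_integrable_sqr.
Qed.

Lemma inL2D f g : inL2 f -> inL2 g -> inL2 (fun x => f x + g x).
Proof.
move=> Lf Lg; have [mf _] := Lf; have [mg _] := Lg.
have mfg : measurable_fun Om (fun x => f x + g x) by exact: measurable_funD.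
apply: inL2P => //.
apply: (@le_integrable_Om _ (fun x => 2 * f x ^+ 2 + 2 * g x ^+ 2)).
- exact: measurable_funX.
- by move=> x _; rewrite ger0_norm ?sqr_ge0//; exact: sqrD_le.
- by apply: integrableD_Om; apply: integrableZ_Om; exact: inL2_integrable_sqr.
Qed.

Lemma inL2Z c f : inL2 f -> inL2 (fun x => c * f x).
Proof.
move=> Lf; have [mf _] := Lf; apply: inL2P; first exact: measurable_funM.
have := integrableZ_Om (c ^+ 2) (inL2_integrable_sqr Lf).
by apply: eq_integrable => // x _ /=; rewrite exprMn.
Qed.

Lemma inL2B f g : inL2 f -> inL2 g -> inL2 (fun x => f x - g x).
Proof.
move=> Lf Lg; have := inL2D Lf (inL2Z (-1) Lg).
by congr inL2; apply/funext => x; rewrite mulN1r.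
Qed.

Lemma bounded_inL2 M f : measurable_fun Om f ->
  (forall x, Om x -> `|f x| <= M) -> inL2 f.
Proof.
move=> mf fM; apply: inL2P => //.
apply: measurable_bounded_integrable => //.
- by have : (mu Om < +oo)%E by rewrite mu_Om ltry.
- exact: measurable_funX.
- exists (M ^+ 2); split; first exact: num_real.
  move=> A MA x Ox /=; rewrite (le_trans _ (ltW MA))// ger0_norm ?sqr_ge0//.
  by rewrite -real_normK ?num_real// lerXn2r ?nnegrE// ?fM// (le_trans _ (fM x Ox)).
Qed.

Lemma continuous_bounded_itv f (a b : R) : continuous f ->
  exists M, forall x, a <= x <= b -> `|f x| <= M.
Proof.
move=> cf; have [ab|ba] := leP a b; last first.
  by exists 0 => x /andP[ax xb]; have := le_trans ax xb; rewrite leNgt ba.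
have cn : {within `[a, b], continuous (fun x => `|f x|)}.
  apply: continuous_subspaceT => x.
  by apply: continuous_comp; [exact: cf|exact: norm_continuous].
have [c _ fc] := EVT_max ab cn.
by exists `|f c| => x axb; apply: fc; rewrite in_itv.
Qed.

Lemma continuous_measurable_Om f : continuous f -> measurable_fun Om f.
Proof.
by move=> cf; apply: measurable_funTS; exact: continuous_measurable_fun.
Qed.

Lemma continuous_inL2 f : continuous f -> inL2 f.
Proof.
move=> cf; have [M fM] := continuous_bounded_itv 0 3 cf.
apply: (@bounded_inL2 M); first exact: continuous_measurable_Om.
by move=> x; rewrite /Om /= in_itv/= => /andP[x0 x3]; apply: fM; rewrite !ltW.
Qed.

Lemma inL2_integrable f : inL2 f -> integrable f.
Proof.
move=> Lf; have L1 : inL2 (cst 1 : R -> R).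
  by apply: continuous_inL2 => x; exact: cvg_cst.
by have := inL2M Lf L1; apply: eq_integrable => // x _ /=; rewrite mulr1.
Qed.

Lemma sqnormD_le f g : inL2 f -> inL2 g ->
  sqnorm (fun x => f x + g x) <= 2 * sqnorm f + 2 * sqnorm g.
Proof.
move=> Lf Lg; have If := inL2_integrable_sqr Lf.
have Ig := inL2_integrable_sqr Lg.
rewrite /sqnorm -!RintegralZl// -RintegralD//; try exact: integrableZ_Om.
apply: le_Rintegral => //.
- exact/inL2_integrable_sqr/inL2D.
- by apply: integrableD_Om; exact: integrableZ_Om.
- by move=> x _; exact: sqrD_le.
Qed.

Lemma sqnormZ c f : inL2 f -> sqnorm (fun x => c * f x) = c ^+ 2 * sqnorm f.
Proof.
move=> Lf; rewrite /sqnorm -RintegralZl//; last exact: inL2_integrable_sqr.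
by apply: eq_Rintegral => x _; rewrite exprMn.
Qed.

(* AM-GM: [|f h| <= (d f^2 + h^2 / d) / 2] *)
Lemma norm_RintegralM_le f h (d : R) : 0 < d -> inL2 f -> inL2 h ->
  `|\int[mu]_(x in Om) (f x * h x)| <= d * sqnorm f + d^-1 * sqnorm h.
Proof.
move=> d0 Lf Lh.
have If := inL2_integrable_sqr Lf; have Ih := inL2_integrable_sqr Lh.
apply: le_trans (le_normr_Rintegral _ (inL2M Lf Lh)) _ => //.
rewrite /sqnorm -!RintegralZl// -RintegralD//; try exact: integrableZ_Om.
apply: le_Rintegral => //.
- exact: (integrable_norm (inL2M Lf Lh)).
- by apply: integrableD_Om; exact: integrableZ_Om.
- move=> x _; rewrite -(@ler_pM2l _ d)// mulrDr !mulrA mulfV ?gt_eqF// mul1r.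
  have -> : d * `|f x * h x| = `|(d * f x) * h x|.
    by rewrite -mulrA [RHS]normrM gtr0_norm.
  by apply: le_trans (norm_mulr_le_sqr _ _) _; rewrite exprMn !expr2 !mulrA.
Qed.

(** Passes between the extended-real integrals of [inH10] and real sequences, for which squeezing
    and the algebra of limits are at hand. *)
Lemma cvg_sqnorm (h : nat -> R -> R) : (forall k, inL2 (h k)) ->
  ((fun k => (\int[mu]_(x in Om) ((h k x ^+ 2)%:E))%E) @ \oo --> 0%E) <->
  (sqnorm (h k) @[k --> \oo] --> 0).
Proof.
move=> Lh.
have -> : (fun k => (\int[mu]_(x in Om) ((h k x ^+ 2)%:E))%E) =
    (fun k => (sqnorm (h k))%:E).
  by apply/funext => k; rewrite EFin_sqnorm.
split; first by move/fine_cvgP => [].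
by move=> H; apply/fine_cvgP; split => //; exact: nearW.
Qed.

Lemma cvg_RintegralM0 f (h : nat -> R -> R) : inL2 f -> (forall k, inL2 (h k)) ->
  sqnorm (h k) @[k --> \oo] --> 0 ->
  \int[mu]_(x in Om) (f x * h k x) @[k --> \oo] --> 0.
Proof.
move=> Lf Lh h0; apply/cvgr0Pnorm_le => e e0.
(* This weight makes d * sqnorm f at most e / 2, the 1 covering the case where [sqnorm f] is 0; once
   sqnorm (h k) <= d * (e / 2), the other term is at most e / 2 too. *)
pose d := e / 2 / (sqnorm f + 1).
have f1 : 0 < sqnorm f + 1 by rewrite ltr_wpDl// sqnorm_ge0.
have d0 : 0 < d by rewrite !divr_gt0.
have /cvgr0Pnorm_le/(_ (d * (e / 2)) _) := h0.
rewrite mulr_gt0 ?divr_gt0// => /(_ isT) nh; near=> k.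
apply: le_trans (norm_RintegralM_le d0 Lf (Lh k)) _.
rewrite [leRHS]splitr; apply: lerD.
  rewrite /d mulrAC ler_pdivrMr// ler_pM2l ?divr_gt0//.
  by rewrite lerDl.
rewrite ler_pdivrMl//; apply: le_trans (ler_norm _) _.
by near: k.
Unshelve. all: by end_near. Qed.

Lemma cvg_RintegralM f g (h : nat -> R -> R) :
  inL2 f -> inL2 g -> (forall k, inL2 (h k)) ->
  sqnorm (fun x => h k x - g x) @[k --> \oo] --> 0 ->
  \int[mu]_(x in Om) (f x * h k x) @[k --> \oo] -->
  \int[mu]_(x in Om) (f x * g x).
Proof.
move=> Lf Lg Lh hg; apply/subr_cvg0.
have := cvg_RintegralM0 Lf (fun k => inL2B (Lh k) Lg) hg.
apply: cvg_trans; apply: near_eq_cvg; near=> k.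
rewrite -RintegralB//; [|exact: inL2M..].
by apply: eq_Rintegral => x _; rewrite mulrBr.
Unshelve. all: by end_near. Qed.

End SquareIntegrable.
#[global] Hint Extern 0 (measurable (@Om _)) => exact: measurable_Om : core.

(** * Density of the test functions among continuous functions in L^2 *)

Section Density.
Context {R : realType}.
Implicit Types (f g h phi : R -> R) (a b c e x : R).
Local Notation mu := (@lebesgue_measure R).
Local Notation Om := (@Om R).

Lemma test_fun_smooth phi : test_fun phi -> smooth phi.
Proof. by case. Qed.

Lemma test_fun_continuous phi : test_fun phi -> continuous phi.
Proof. by move=> /test_fun_smooth; exact: smooth_continuous. Qed.

Lemma test_fun_derive1_continuous phi : test_fun phi -> continuous (derive1 phi).
Proof.
by move=> /test_fun_smooth sphi; exact/smooth_continuous/smooth_derive1.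
Qed.

Lemma test_fun_inL2 phi : test_fun phi -> inL2 phi.
Proof. by move=> /test_fun_continuous; exact: continuous_inL2. Qed.

Lemma test_fun_derive1_inL2 phi : test_fun phi -> inL2 (derive1 phi).
Proof. by move=> /test_fun_derive1_continuous; exact: continuous_inL2. Qed.

Lemma test_funD f g : test_fun f -> test_fun g -> test_fun (fun x => f x + g x).
Proof.
move=> [sf [a [b [a0 [b3 fab]]]]] [sg [a' [b' [a'0 [b'3 gab]]]]].
split; first exact: smoothD.
exists (Num.min a a'), (Num.max b b'); split; first by rewrite lt_min a0.
split; first by rewrite gt_max b3.
move=> x [|]; rewrite ?lt_min ?gt_max => /andP[xa xa'].
  by rewrite fab ?gab ?addr0//; left.
by rewrite fab ?gab ?addr0//; right.
Qed.

Lemma test_funZ c f : test_fun f -> test_fun (fun x => c * f x).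
Proof.
move=> [sf [a [b [a0 [b3 fab]]]]]; split; first exact: smoothZ.
by exists a, b; do 2 split => //; move=> x /fab ->; rewrite mulr0.
Qed.

Lemma flat1_ge0 x : 0 <= flat 1 x.
Proof. by rewrite /flat; case: ifP; rewrite // hornerE mul1r expR_ge0. Qed.

Lemma flat1_le1 x : flat 1 x <= 1.
Proof.
rewrite /flat; case: ifP => // x0.
by rewrite hornerE mul1r expR_le1 oppr_le0 invr_ge0 ltW.
Qed.

Lemma flat1_eq0 x : x <= 0 -> flat 1 x = 0.
Proof. by rewrite /flat leNgt => /negPf ->. Qed.

Lemma flat1_cvg1 (t : R) : 0 < t -> flat 1 (k.+1%:R * t - 1) @[k --> \oo] --> (1 : R).
Proof.
move=> t0; apply/cvgrPdist_le => e e0; near=> k.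
(* Let [y] be the inverse of the argument. Then y <= e, and 1 - exp (- y) <= y concludes. *)
have ekt : e^-1 <= k.+1%:R * t - 1.
  rewrite lerBrDr -ler_pdivrMr//.
  apply: (@le_trans _ _ k%:R); last by rewrite ler_nat.
  by near: k; exact: nbhs_infty_ger.
have kt0 : 0 < k.+1%:R * t - 1 by apply: lt_le_trans ekt; rewrite invr_gt0.
rewrite ger0_norm ?subr_ge0 ?flat1_le1// /flat kt0 hornerE mul1r.
rewrite lerBlDr; set y := _^-1.
have ye : y <= e by rewrite /y invf_ple ?posrE.
have := expR_ge1Dx (- y); lra.
Unshelve. all: by end_near. Qed.

(* The dilation makes [bump a b k] tend to the indicator of (a, b) as k grows;
   the shift by 1 confines its support to [a + 1/(k+1), b - 1/(k+1)]. *)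
Definition bump a b (k : nat) x : R :=
  flat 1 (k.+1%:R * (x - a) - 1) * flat 1 (k.+1%:R * (b - x) - 1).

Lemma bump_ge0 a b k x : 0 <= bump a b k x.
Proof. by rewrite mulr_ge0// flat1_ge0. Qed.

Lemma bump_le1 a b k x : bump a b k x <= 1.
Proof. by rewrite mulr_ile1 ?flat1_ge0 ?flat1_le1. Qed.

Lemma test_fun_bump a b k : 0 <= a -> b <= 3 -> test_fun (bump a b k).
Proof.
move=> a0 b3; have k0 : 0 < k.+1%:R :> R by rewrite ltr0n.
split.
  apply: (@smoothM _ (fun x => flat 1 (k.+1%:R * (x - a) - 1))
                     (fun x => flat 1 (k.+1%:R * (b - x) - 1))).
    have := @smooth_comp_affine _ (flat 1) k.+1%:R (- (k.+1%:R * a) - 1)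
      (@smooth_flat R 1).
    by congr smooth; apply/funext => x; congr flat; ring.
  have := @smooth_comp_affine _ (flat 1) (- k.+1%:R) (k.+1%:R * b - 1)
    (@smooth_flat R 1).
  by congr smooth; apply/funext => x; congr flat; ring.
exists (a + k.+1%:R^-1), (b - k.+1%:R^-1); split.
  by rewrite ltr_wpDl// invr_gt0.
split; first by rewrite ltrBlDr (le_lt_trans b3)// ltrDl invr_gt0.
move=> x [xa|bx]; rewrite /bump.
  rewrite flat1_eq0 ?mul0r// subr_le0 -ler_pdivlMl// mulr1.
  by rewrite lerBlDl ltW.
rewrite [X in _ * X]flat1_eq0 ?mulr0// subr_le0 -ler_pdivlMl// mulr1.
by rewrite lerBlDl -lerBlDr ltW.
Qed.

(** The point [a] is excluded because every bump vanishes there, while a nonempty [a, b) contains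
    it. Half-open intervals are chosen because consecutive ones tile [0, 3) without overlap. *)
Lemma bump_cvg a b x : x != a ->
  bump a b k x @[k --> \oo] --> (\1_(`[a, b[ : set R) x : R).
Proof.
move=> xa; rewrite indicE.
case: (boolP (x \in _)) => /=; rewrite ?inE ?notin_setE /=.
  rewrite in_itv/= => /andP[ax xb]; rewrite -[X in _ --> X]mulr1.
  have {}ax : a < x by rewrite lt_neqAle eq_sym xa.
  by apply: cvgM; apply: flat1_cvg1; rewrite subr_gt0.
move=> nab; rewrite (_ : (fun k => _) = cst 0); first exact: cvg_cst.
apply/funext => k; rewrite /bump.
have k0 : 0 < k.+1%:R :> R by rewrite ltr0n.
have [ax|xa'] := leP a x; last first.
  by rewrite flat1_eq0 ?mul0r// subr_le0 (@le_trans _ _ 0)// pmulr_rle0// subr_le0 ltW.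
have bx : b <= x.
  by rewrite leNgt; apply/negP => xb; apply: nab; rewrite /= in_itv/= ax.
rewrite [X in _ * X]flat1_eq0 ?mulr0// subr_le0 (@le_trans _ _ 0)//.
by rewrite pmulr_rle0// subr_le0.
Qed.

Lemma indic_inL2 (A : set R) : measurable A -> inL2 (\1_A : R -> R).
Proof.
move=> mA; apply: (@bounded_inL2 _ 1).
  exact: measurable_indic.
by move=> x _; rewrite indicE; case: (x \in A); rewrite ?normr0 ?normr1.
Qed.

Lemma bump_sqnorm_cvg a b :
  sqnorm (fun x => bump a b k x - \1_(`[a, b[ : set R) x) @[k --> \oo] --> 0.
Proof.
have Lb k : inL2 (fun x => bump a b k x - \1_(`[a, b[ : set R) x).
  apply: inL2B; last by apply: indic_inL2; exact: measurable_itv.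
  apply: continuous_inL2 => x.
  have cf y : {for y, continuous (flat (1 : {poly R}))}.
    exact/smooth_continuous/smooth_flat.
  apply: (@continuousM _ _ (fun x => flat 1 (k.+1%:R * (x - a) - 1))
                       (fun x => flat 1 (k.+1%:R * (b - x) - 1))).
    apply: (@continuous_comp _ _ _ (fun x => k.+1%:R * (x - a) - 1)) => //.
    apply: cvgB; last exact: cvg_cst.
    apply: cvgM; first exact: cvg_cst.
    by apply: cvgB; [exact: cvg_id|exact: cvg_cst].
  apply: (@continuous_comp _ _ _ (fun x => k.+1%:R * (b - x) - 1)) => //.
  apply: cvgB; last exact: cvg_cst.
  apply: cvgM; first exact: cvg_cst.
  by apply: cvgB; [exact: cvg_cst|exact: cvg_id].
apply/cvg_sqnorm => //.
rewrite [X in _ --> X](_ : _ = \int[mu]_(x in Om) (0%:E))%E; last first.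
  by rewrite integral0.
(* The squares tend to 0 off the null set {a}, and are at most 1 because the bump and the indicator
   both take values in [0, 1]. *)
have [] := @dominated_convergence _ _ _ mu Om _
  (fun k x => ((bump a b k x - \1_(`[a, b[ : set R) x) ^+ 2)%:E)
  (fun=> 0%:E) (fun=> 1%:E) => //.
- move=> k; apply/measurable_EFinP; apply: measurable_funX.
  by have [] := Lb k.
- exists [set a]; split; [exact: measurable_set1|exact: lebesgue_measure_set1|].
  move=> x /= H; apply: contrapT => xa; apply: H => _.
  apply: cvg_EFin; first exact: nearW.
  rewrite -[X in _ --> X](@expr0n R 2).
  have /subr_cvg0 d0 : bump a b k x @[k --> \oo] --> (\1_(`[a, b[ : set R) x : R).
    by apply: bump_cvg; apply/eqP.
  by rewrite /comp/=; under eq_fun do rewrite expr2; rewrite expr2; exact: cvgM.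
- have L1 : inL2 (cst 1 : R -> R) by apply: continuous_inL2 => x; exact: cvg_cst.
  exact: inL2_integrable L1.
- apply: aeW => x k _; rewrite /= lee_fin ger0_norm ?sqr_ge0//.
  rewrite -real_normK ?num_real// expr_le1// ler_norml indicE.
  have := bump_ge0 a b k x; have := bump_le1 a b k x.
  by case: (_ \in _) => /= *; apply/andP; split; lra.
Qed.

(** This is the closure of the test functions in L^2, with the tolerance put on the squared norm. *)
Definition approximable f := inL2 f /\
  forall e, 0 < e -> exists2 phi, test_fun phi & sqnorm (fun x => phi x - f x) <= e.

Lemma approximable_indic a b : 0 <= a -> b <= 3 ->
  approximable (\1_(`[a, b[ : set R) : R -> R).
Proof.
move=> a0 b3; split; first by apply: indic_inL2; exact: measurable_itv.
move=> e e0; have /cvgr0Pnorm_le/(_ e e0)[k _ /(_ k)] := bump_sqnorm_cvg a b.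
rewrite /= leqnn => /(_ isT) ke; exists (bump a b k); first exact: test_fun_bump.
exact: le_trans (ler_norm _) ke.
Qed.

Lemma approximable0 : approximable (fun=> 0).
Proof.
have := @approximable_indic 0 0 (lexx 0); rewrite ler0n => /(_ isT).
congr approximable; apply/funext => x.
by rewrite set_itvco0 indic0.
Qed.

Lemma approximableD f g :
  approximable f -> approximable g -> approximable (fun x => f x + g x).
Proof.
move=> [Lf af] [Lg ag]; split; first exact: inL2D.
(* [sqnormD_le] doubles each of the two errors, hence the quarter. *)
move=> e e0; have e4 : 0 < e / 4 by rewrite divr_gt0.
have [p tp pf] := af _ e4; have [q tq qg] := ag _ e4.
exists (fun x => p x + q x); first exact: test_funD.
have Lpf := inL2B (test_fun_inL2 tp) Lf; have Lqg := inL2B (test_fun_inL2 tq) Lg.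
have := sqnormD_le Lpf Lqg.
rewrite (_ : (fun x => p x - f x + (q x - g x)) =
             (fun x => p x + q x - (f x + g x))).
  by move=> H; lra.
by apply/funext => x; ring.
Qed.

Lemma approximableZ c f : approximable f -> approximable (fun x => c * f x).
Proof.
move=> [Lf af]; split; first exact: inL2Z.
move=> e e0; have c0 : 0 < c ^+ 2 + 1 by rewrite ltr_wpDl// sqr_ge0.
have [p tp pf] := af (e / (c ^+ 2 + 1)) (divr_gt0 e0 c0).
exists (fun x => c * p x); first exact: test_funZ.
rewrite (_ : (fun x => _) = (fun x => c * (p x - f x))); last first.
  by apply/funext => x; rewrite mulrBr.
rewrite sqnormZ; last by apply: inL2B => //; exact: test_fun_inL2.
apply: le_trans (ler_wpM2l (sqr_ge0 c) pf) _.
by rewrite mulrA ler_pdivrMr// mulrC ler_pM2l// lerDl.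
Qed.

Lemma sqnorm_le c f : inL2 f -> (forall x, Om x -> `|f x| <= c) ->
  sqnorm f <= 3 * c ^+ 2.
Proof.
move=> Lf fc.
have -> : 3 * c ^+ 2 = \int[mu]_(x in Om) (c ^+ 2).
  rewrite Rintegral_cst; last exact: measurable_Om.
  have -> : fine (mu Om) = 3 by rewrite mu_Om.
  by rewrite mulrC.
apply: le_Rintegral => //.
- exact: inL2_integrable_sqr.
- by apply: inL2_integrable; apply: continuous_inL2 => x; exact: cvg_cst.
- move=> x Ox; rewrite -real_normK ?num_real// lerXn2r ?nnegrE ?fc//.
  exact: le_trans (fc x Ox).
Qed.

(** Heine-Cantor, from the near-covering form of compactness along [d] tending to 0 from the right.
    Only [x] is confined to the segment. *)
Lemma continuous_unif_itv f a b e : continuous f -> 0 < e ->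
  exists2 d, 0 < d &
    forall x y, a <= x <= b -> `|x - y| < d -> `|f x - f y| <= e.
Proof.
move=> cf e0.
have /compact_near_coveringP := @segment_compact R a b.
move=> /(_ R (0 : R)^'+ (fun d x => forall y, `|x - y| < d -> `|f x - f y| <= e)).
move=> /(_ _ _)[].
  move=> x _; have e2 : 0 < e / 2 by rewrite divr_gt0.
  have /cvgrPdist_le/(_ _ e2)/nbhs_ballP[r /= r0 fr] := cf x.
  have r2 : 0 < r / 2 by rewrite divr_gt0.
  (* Halving the radius keeps both x' and y within r of the centre [x]. *)
  exists (ball x (r / 2), [set d | d <= r / 2]); first split => /=.
  - exact: nbhsx_ballx.
  - exact: nbhs_right_le.
  move=> [x' d] [/= xx' dr] y x'y.
  have fx' : `|f x - f x'| <= e / 2.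
    by apply: fr; apply: le_ball xx'; lra.
  have fy : `|f x - f y| <= e / 2.
    apply: fr; rewrite /ball/= (splitr r).
    rewrite (_ : x - y = (x - x') + (x' - y)); last by ring.
    rewrite (le_lt_trans (ler_normD _ _))// ltrD// (lt_le_trans x'y)//.
  rewrite (_ : f x' - f y = (f x' - f x) + (f x - f y)); last by ring.
  rewrite (le_trans (ler_normD _ _))// [leRHS]splitr lerD// distrC//.
move=> r /= r0 H; exists (r / 2); first by rewrite divr_gt0.
move=> x y axb xy; apply: (H (r / 2)) => //=.
- by rewrite sub0r normrN gtr0_norm ?divr_gt0//; lra.
- by rewrite divr_gt0.
Qed.

(** By uniform continuity [f] is uniformly close on (0, 3) to a step function, which is a linear
    combination of indicators and hence approximable. *)
Lemma approximable_continuous f : continuous f -> approximable f.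
Proof.
move=> cf; have Lf := continuous_inL2 cf; split => // e e0.
(* A uniform error [c] costs 3 c^2 <= 3 c <= e / 4 in squared norm. The test function is within e /
   4 of the step function, and [sqnormD_le] brings the total to e. *)
pose c := Num.min 1 (e / 12).
have c0 : 0 < c by rewrite lt_min ltr01 divr_gt0.
have [d d0 fd] := continuous_unif_itv 0 3 cf c0.
have [N Nd] : exists N : nat, 3 / d < N%:R.
  exists (Num.bound (3 / d)); apply: archi_boundP.
  by rewrite divr_ge0// ltW.
have N0 : 0 < N%:R :> R by apply: le_lt_trans Nd; rewrite divr_ge0// ltW.
pose t : R := 3 / N%:R.
have t0 : 0 < t by rewrite divr_gt0.
have td : t < d by rewrite /t ltr_pdivrMr// mulrC -ltr_pdivrMr.
(* The step function is built one piece at a time. Its vanishing to the right of the pieces already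
   placed lets the next piece, with the value of [f] at its left end, be added without
   interference. *)
have step n : (n <= N)%N -> exists h, [/\ approximable h,
    forall x, 0 <= x -> x < n%:R * t -> `|h x - f x| <= c &
    forall x, n%:R * t <= x -> h x = 0].
  elim: n => [|n IH] nN.
    exists (fun=> 0); split => //; first exact: approximable0.
    by move=> x x0; rewrite mul0r ltNge x0.
  have [h [ah hf h0]] := IH (ltnW nN).
  have nt3 : n.+1%:R * t <= 3.
    by rewrite /t mulrCA ler_piMr// ler_pdivrMr// mul1r ler_nat.
  have ntS : n.+1%:R * t = n%:R * t + t by rewrite -natr1 mulrDl mul1r.
  have nt0 : 0 <= n%:R * t by rewrite mulr_ge0// ltW.
  exists (fun x => h x + f (n%:R * t) * \1_(`[n%:R * t, n.+1%:R * t[ : set R) x).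
  split.
  - by apply: approximableD => //; apply: approximableZ; exact: approximable_indic.
  - move=> x x0 xn; have [xnt|ntx] := ltP x (n%:R * t).
      rewrite indicE (_ : _ \in _ = false) ?mulr0 ?addr0 ?hf//.
      by apply/negbTE; rewrite notin_setE/= in_itv/= leNgt xnt.
    rewrite h0// add0r indicE mem_set ?mulr1/= ?in_itv/= ?ntx//.
    apply: fd; first by rewrite nt0 /=; lra.
    by rewrite distrC ger0_norm ?subr_ge0//; lra.
  - move=> x nx; rewrite h0 ?add0r; last by lra.
    rewrite indicE (_ : _ \in _ = false) ?mulr0//.
    by apply/negbTE; rewrite notin_setE/= in_itv/= ltNge nx andbF.
have [h [[Lh ah] hf _]] := step N (leqnn N).
have [p tp ph] := ah (e / 4) (divr_gt0 e0 (ltr0n _ 4)).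
exists p => //.
have Lph := inL2B (test_fun_inL2 tp) Lh; have Lhf := inL2B Lh Lf.
have := sqnormD_le Lph Lhf.
rewrite (_ : (fun x => p x - h x + (h x - f x)) = (fun x => p x - f x)); last first.
  by apply/funext => x; ring.
have hfc : sqnorm (fun x => h x - f x) <= 3 * c ^+ 2.
  apply: sqnorm_le => // x; rewrite /Om/= in_itv/= => /andP[x0 x3].
  by apply: hf; [exact: ltW|rewrite mulrC divfK ?gt_eqF].
have c12 : c <= e / 12 by rewrite ge_min lexx orbT.
have c1 : c <= 1 by rewrite ge_min lexx.
have : c ^+ 2 <= c by rewrite expr2 ler_piMr// ltW.
by move=> *; lra.
Qed.

Lemma approximable_seq f : approximable f -> exists phis : nat -> R -> R,
  (forall k, test_fun (phis k)) /\
  sqnorm (fun x => phis k x - f x) @[k --> \oo] --> 0.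
Proof.
move=> [Lf af]; have H k : {phi | test_fun phi &
    sqnorm (fun x => phi x - f x) <= k.+1%:R^-1}.
  by apply: cid2; apply: af; rewrite invr_gt0.
exists (fun k => s2val (H k)); split; first by move=> k; exact: (s2valP (H k)).
apply: (@squeeze_cvgr _ _ _ _ (fun=> 0) (@harmonic R)).
- by apply: nearW => k; rewrite sqnorm_ge0 /=; exact: (s2valP' (H k)).
- exact: cvg_cst.
- exact: cvg_harmonic.
Qed.

End Density.

(** * Primitives, integration by parts and membership in H^1_0 *)

Section Primitives.
Context {R : realType}.
Implicit Types (F f u g h phi : R -> R) (a b c d e x y : R).
Local Notation mu := (@lebesgue_measure R).
Local Notation Om := (@Om R).

Lemma continuous_integrable_itv f a b (b1 b2 : bool) : continuous f ->
  mu.-integrable [set` Interval (BSide b1 a) (BSide b2 b)] (EFin \o f).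
Proof.
move=> cf; have cab : mu.-integrable `[a, b] (EFin \o f).
  apply: continuous_compact_integrable; first exact: segment_compact.
  exact: continuous_subspaceT.
apply: integrableS cab; [exact: measurable_itv|exact: measurable_itv|].
by apply: subset_itv; [case: b1|case: b2]; rewrite bnd_simp.
Qed.

Lemma continuous_Rintegral_itv_oo_cc f a b : continuous f ->
  \int[mu]_(x in `]a, b[) f x = \int[mu]_(x in `[a, b]) f x.
Proof.
move=> cf; rewrite Rintegral_itv_obnd_cbnd; last exact: continuous_integrable_itv.
by rewrite Rintegral_itv_bndo_bndc//; exact: continuous_integrable_itv.
Qed.

Lemma Rintegral_itv_oo_split f a b c : a < b -> b < c ->
  mu.-integrable `]a, c[ (EFin \o f) ->
  \int[mu]_(x in `]a, c[) f x =
  \int[mu]_(x in `]a, b[) f x + \int[mu]_(x in `]b, c[) f x.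
Proof.
move=> ab bc fi.
have fi' : mu.-integrable `]a, b[ (EFin \o f).
  apply: integrableS fi; [exact: measurable_itv|exact: measurable_itv|].
  by apply: subset_itvl; rewrite bnd_simp ltW.
rewrite [X in X + _]Rintegral_itv_bndo_bndc//.
by rewrite -(@Rintegral_itvB _ f (BRight a) (BLeft c) b)// ?bnd_simp ?ltW// addrC subrK.
Qed.

Lemma derivable_oo_continuous F f a b : continuous F ->
  (forall x, a < x < b -> is_derive x 1 F (f x)) ->
  derivable_oo_LRcontinuous F a b.
Proof.
move=> cF dF; split.
- by move=> x; rewrite in_itv => /dF[].
- exact: cvg_at_right_filter (cF a).
- exact: cvg_at_left_filter (cF b).
Qed.

Lemma Rintegral_FTC2 F f a b : a < b -> continuous f -> continuous F ->
  (forall x, a < x < b -> is_derive x 1 F (f x)) ->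
  \int[mu]_(x in `]a, b[) f x = F b - F a.
Proof.
move=> ab cf cF dF; rewrite continuous_Rintegral_itv_oo_cc// /Rintegral.
rewrite (@continuous_FTC2 _ f F)//.
- exact: continuous_subspaceT.
- exact: derivable_oo_continuous dF.
- by move=> x; rewrite in_itv => /dF; exact: is_derive_derive1.
Qed.

(** Differentiability is asked only inside (a, b), with [f] a continuous function on the whole line:
    this suits u', whose derivative may jump at 1 and 2, on each unit interval. *)
Lemma Rintegral_by_parts F f phi a b : a < b -> continuous F -> continuous f ->
  (forall x, a < x < b -> is_derive x 1 F (f x)) -> smooth phi ->
  \int[mu]_(x in `]a, b[) (F x * derive1 phi x) =
  F b * phi b - F a * phi a - \int[mu]_(x in `]a, b[) (f x * phi x).
Proof.
move=> ab cF cf dF sphi; have cphi := smooth_continuous sphi.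
have cphi' := smooth_continuous (smooth_derive1 sphi).
rewrite !continuous_Rintegral_itv_oo_cc.
- apply: Rintegration_by_parts => //.
  + exact: continuous_subspaceT.
  + exact: derivable_oo_continuous dF.
  + by move=> x; rewrite in_itv => /dF; exact: is_derive_derive1.
  + exact: continuous_subspaceT.
  + apply: (@derivable_oo_continuous _ (derive1 phi)) => // x _.
    exact: smooth_is_derive.
- by move=> x; exact: (cvgM (cf x) (cphi x)).
- by move=> x; exact: (cvgM (cF x) (cphi' x)).
Qed.

Lemma test_fun0 phi : test_fun phi -> phi 0 = 0.
Proof. by case=> _ [a [b [a0 [_ h]]]]; apply: h; left. Qed.

Lemma test_fun3 phi : test_fun phi -> phi 3 = 0.
Proof. by case=> _ [a [b [_ [b3 h]]]]; apply: h; right. Qed.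

Lemma C1_weak_deriv u g : continuous g ->
  (forall x, is_derive x 1 u (g x)) -> weak_deriv u g.
Proof.
move=> cg du phi tphi.
have cu : continuous u by move=> x; exact: is_derive_continuous (du x).
rewrite /Om Rintegral_by_parts//; last exact: test_fun_smooth.
by rewrite (test_fun0 tphi) (test_fun3 tphi) !mulr0 subrr sub0r.
Qed.

Lemma is_derive0_eq_right F b x y :
  (forall z, b < z -> is_derive z 1 F 0) -> b < x -> b < y -> F x = F y.
Proof.
move=> dF; wlog xy : x y / x <= y.
  by move=> H bx by_; case: (leP x y) => [|/ltW] xy; [|apply/esym]; exact: H.
move=> bx by_; have [||z _] := @MVT_segment _ F (cst 0) x y xy.
- move=> z; rewrite in_itv/= => /andP[xz _]; apply: dF; exact: lt_trans xz.
- apply: continuous_in_subspaceT => z; rewrite inE/= in_itv/= => /andP[xz _].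
  by apply: is_derive_continuous (dF z _); exact: lt_le_trans xz.
- by rewrite mul0r => /subr0_eq.
Qed.

Lemma test_fun_primitive f : test_fun f -> \int[mu]_(x in Om) f x = 0 ->
  exists2 F, test_fun F & forall x, is_derive x 1 F (f x).
Proof.
move=> tf f0; have cf := test_fun_continuous tf.
have [sf [a [b [a0 [b3 fab]]]]] := tf.
(* Starting at -1 makes every x >= 0 lie strictly to the right of the base point, as the fundamental
   theorem requires; around x < 0 the primitive is locally 0. *)
pose F x := \int[mu]_(t in `[-1, x]) f t.
have F0 x : x < a -> F x = 0.
  move=> xa; rewrite /F (@eq_Rintegral _ _ _ _ _ (cst 0)).
    by rewrite Rintegral_cst ?mul0r//; exact: measurable_itv.
  move=> t; rewrite inE/= in_itv/= => /andP[_ tx].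
  by apply: fab; left; exact: le_lt_trans xa.
have dF x : is_derive x 1 F (f x).
  have [x0|x0] := ltP x 0.
    rewrite fab; last by left; exact: lt_trans a0.
    have : is_derive x 1 (cst 0 : R -> R) 0 by exact: is_derive_cst.
    apply: near_eq_is_derive; near=> y; rewrite F0//.
    by apply: (@lt_trans _ _ 0) => //; near: y; exact: lt_nbhsl.
  have [||||dFx F'x] := @continuous_FTC1_closed _ f (-1) x (x + 1).
  - by rewrite ltrDl.
  - exact: continuous_integrable_itv.
  - by rewrite (lt_le_trans _ x0)// ltrN10.
  - exact: cf.
  by rewrite -F'x; exact: derivable_is_derive1.
have cF : continuous F by move=> x; exact: is_derive_continuous (dF x).
exists F => //; split; first exact: smooth_antiderivative dF sf.
exists a, b; do 2 split => //; move=> x [|bx]; first exact: F0.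
(* To the right of the support [F] is constant, and its value at 3 is the integral of [f], which is
   0. *)
have -> : F x = F 3.
  apply: is_derive0_eq_right bx b3 => z bz.
  by rewrite -(fab z); [exact: dF|right].
have := @Rintegral_FTC2 F f 0 3 (ltr0n _ 3) cf cF (fun x _ => dF x).
by rewrite -/Om f0 (F0 0)// subr0.
Unshelve. all: by end_near. Qed.

Lemma inL2_cst c : inL2 (cst c : R -> R).
Proof. by apply: continuous_inL2 => x; exact: cvg_cst. Qed.

Lemma sqnorm_cst1 : sqnorm (cst 1 : R -> R) = 3.
Proof.
rewrite /sqnorm (@eq_Rintegral _ _ _ _ _ (cst 1)); last by move=> x _; rewrite expr1n.
rewrite Rintegral_cst; last exact: measurable_Om.
have -> : fine (mu Om) = 3 by rewrite mu_Om.
by rewrite mul1r.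
Qed.

(** Supplies the function used to correct means. A test function within 1/3 of the constant 1 in
    squared norm will do: with weight 1/3 the AM-GM bound shows that its integral differs from 3 by
    at most 1 + 1. *)
Lemma test_fun_integral_gt0 :
  exists2 phi, test_fun phi & 0 < \int[mu]_(x in Om) phi x.
Proof.
have [_ /(_ (3^-1))[]] := @approximable_continuous R (cst 1) (fun x => cvg_cst _).
  by rewrite invr_gt0.
move=> phi tphi phi1; exists phi => //.
have Lphi := test_fun_inL2 tphi; have L1 := inL2_cst 1.
have d0 : 0 < 3^-1 :> R by rewrite invr_gt0.
have <- : \int[mu]_(x in Om) (cst 1 x * (phi x - cst 1 x)) + 3 =
    \int[mu]_(x in Om) phi x.
  rewrite (_ : Rintegral _ _ _ = \int[mu]_(x in Om) (phi x - cst 1 x)).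
    rewrite RintegralB//; [|exact: inL2_integrable..].
    rewrite Rintegral_cst; last exact: measurable_Om.
    have -> : fine (mu Om) = 3 by rewrite mu_Om.
    by rewrite mul1r subrK.
  by apply: eq_Rintegral => x _; rewrite mul1r.
have := norm_RintegralM_le d0 L1 (inL2B Lphi L1).
rewrite sqnorm_cst1 mulVf// invrK.
rewrite ler_norml => /andP[+ _].
have : sqnorm (fun x => phi x - 1) <= 3^-1 := phi1.
by set s := sqnorm _ => *; lra.
Qed.

(** A Poincaré inequality in which [d] plays the role of the norm of [h]. The AM-GM bound with
    weight [d] gives |u| <= 3 d + d, and squaring this over an interval of length 3 gives 48 d^2. *)
Lemma sqnorm_primitive_le u h d : 0 < d -> continuous h ->
  (forall x, is_derive x 1 u (h x)) -> u 0 = 0 -> sqnorm h <= d ^+ 2 ->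
  sqnorm u <= 48 * d ^+ 2.
Proof.
move=> d0 ch du u0 hd.
have cu : continuous u by move=> x; exact: is_derive_continuous (du x).
have -> : 48 * d ^+ 2 = 3 * (4 * d) ^+ 2 by ring.
apply: sqnorm_le; first exact: continuous_inL2.
move=> x; rewrite /Om/= in_itv/= => /andP[x0 x3].
have -> : u x = \int[mu]_(t in `]0, x[) h t.
  by rewrite (@Rintegral_FTC2 u)// u0 subr0.
have cnh : continuous (fun t => `|h t|).
  by move=> t; apply: continuous_comp; [exact: ch|exact: norm_continuous].
apply: le_trans (le_normr_Rintegral _ _) _.
- exact: measurable_itv.
- exact: continuous_integrable_itv.
apply: (@le_trans _ _ (\int[mu]_(t in Om) `|h t|)).
  rewrite /Om (Rintegral_itv_oo_split x0 x3); last exact: continuous_integrable_itv.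
  by rewrite lerDl; apply: Rintegral_ge0.
have Lnh : inL2 (fun t => `|h t|) by exact: continuous_inL2.
have := norm_RintegralM_le d0 (inL2_cst 1) Lnh.
rewrite (_ : Rintegral _ _ _ = \int[mu]_(t in Om) `|h t|); last first.
  by apply: eq_Rintegral => t _; rewrite mul1r.
move=> /(le_trans (ler_norm _)) /le_trans; apply.
have -> : sqnorm (fun t => `|h t|) = sqnorm h.
  by apply: eq_Rintegral => t _; rewrite real_normK ?num_real.
rewrite sqnorm_cst1; have : d^-1 * sqnorm h <= d.
  by rewrite ler_pdivrMl// -expr2.
by move=> *; lra.
Qed.

Lemma C1_inH10 u g : continuous g -> (forall x, is_derive x 1 u (g x)) ->
  u 0 = 0 -> u 3 = 0 -> inH10 u.
Proof.
move=> cg du u0 u3.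
have cu : continuous u by move=> x; exact: is_derive_continuous (du x).
have Lu := continuous_inL2 cu; have Lg := continuous_inL2 cg.
have wug := C1_weak_deriv cg du.
split; first by split=> //; exists g.
exists g; split=> //; split=> //.
have [theta [ttheta theta_g]] := approximable_seq (approximable_continuous cg).
have [rho trho] := test_fun_integral_gt0.
set m := Rintegral _ _ _ => m0.
(* Subtracting [c k] times [rho] gives [theta k] mean zero. The correction tends to 0, since the
   integrals of [theta k] tend to that of [g], namely u 3 - u 0 = 0. *)
pose c k := (\int[mu]_(x in Om) theta k x) / m.
pose psi k x := theta k x + (- c k) * rho x.
have tpsi k : test_fun (psi k) by apply: test_funD => //; exact: test_funZ.
have Lth k := test_fun_inL2 (ttheta k).
have Lrho := test_fun_inL2 trho.
have c0 : c k @[k --> \oo] --> (0 : R).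
  have := cvg_RintegralM (inL2_cst 1) Lg Lth theta_g.
  rewrite (_ : \int[mu]_(x in Om) (cst 1 x * g x) = 0); last first.
    transitivity (u 3 - u 0); last by rewrite u0 u3 subrr.
    rewrite -(@Rintegral_FTC2 u g 0 3 (ltr0n _ 3) cg cu (fun x _ => du x)).
    by apply: eq_Rintegral => x _; rewrite mul1r.
  move=> /(cvgM (@cvg_cst _ m^-1 _ \oo _)); rewrite mulr0.
  apply: cvg_trans; apply: near_eq_cvg; apply: nearW => k /=.
  rewrite /c mulrC; congr (_ * _).
  by apply: eq_Rintegral => x _; rewrite mul1r.
have psi0 k : \int[mu]_(x in Om) psi k x = 0.
  rewrite RintegralD//; [|exact: inL2_integrable|]; last first.
    exact/inL2_integrable/inL2Z.
  rewrite RintegralZl//; last exact: inL2_integrable.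
  by rewrite -/m mulNr divfK ?subrr// gt_eqF.
have psi_g : sqnorm (fun x => psi k x - g x) @[k --> \oo] --> 0.
  apply: (@squeeze_cvgr _ _ _ _ (fun=> 0)
    (fun k => 2 * sqnorm (fun x => theta k x - g x) + 2 * (c k ^+ 2 * sqnorm rho))).
  - apply: nearW => k; rewrite sqnorm_ge0/= -(sqrrN (c k)) -sqnormZ//.
    apply: le_trans (sqnormD_le _ _); last 2 first.
    + exact: inL2B.
    + exact: inL2Z.
    rewrite le_eqVlt; apply/orP; left; apply/eqP; congr sqnorm.
    by apply/funext => x; rewrite /psi addrAC.
  - exact: cvg_cst.
  - rewrite [X in _ --> X](_ : 0 = 2 * 0 + 2 * (0 ^+ 2 * sqnorm rho)); last by ring.
    apply: cvgD; first by apply: cvgM => //; exact: cvg_cst.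
    apply: cvgM; first exact: cvg_cst.
    by apply: cvgM; [under eq_fun do rewrite expr2; rewrite expr2; exact: cvgM|exact: cvg_cst].
have prim k : {F | test_fun F & forall x, is_derive x 1 F (psi k x)}.
  by apply: cid2; exact: test_fun_primitive.
pose phi k := s2val (prim k).
have tphi k : test_fun (phi k) := s2valP (prim k).
have dphi k x : is_derive x 1 (phi k) (psi k x) := s2valP' (prim k) x.
have phi' k : derive1 (phi k) = psi k.
  by apply/funext => x; exact: is_derive_derive1.
exists phi; split => //; split; last first.
  apply/cvg_sqnorm => [k|].
    by apply: inL2B => //; rewrite phi'; exact: test_fun_inL2.
  by under eq_fun do rewrite phi'.
apply/cvg_sqnorm => [k|]; first by apply: inL2B => //; exact: test_fun_inL2.
apply/cvgr0Pnorm_le => e e0.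
(* Then 48 d^2 <= 48 d <= e, ready for [sqnorm_primitive_le] applied to [phi k] minus [u], which
   vanishes at 0 and has derivative [psi k] minus [g]. *)
pose d := Num.min 1 (e / 48).
have d0 : 0 < d by rewrite lt_min ltr01 divr_gt0.
have d48 : 48 * d ^+ 2 <= e.
  have d1 : d <= 1 by rewrite ge_min lexx.
  have de : d <= e / 48 by rewrite ge_min lexx orbT.
  have : d ^+ 2 <= d by rewrite expr2 ler_piMr// ltW.
  by move=> *; lra.
have /cvgr0Pnorm_le/(_ (d ^+ 2) (exprn_gt0 _ d0)) psid := psi_g.
near=> k; rewrite ger0_norm ?sqnorm_ge0//; apply: le_trans d48.
apply: (@sqnorm_primitive_le _ (fun x => psi k x - g x)) => //.
- move=> x; apply: cvgB; last exact: cg.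
  exact: (test_fun_continuous (tpsi k)).
- by rewrite test_fun0// u0 subrr.
- by apply: le_trans (ler_norm _) _; near: k.
Unshelve. all: by end_near. Qed.

End Primitives.

(** * From piecewise classical solutions to weak solutions *)

Section WeakSolutions.
Context {R : realType}.
Implicit Types (u g w phi psi : R -> R) (lam x : R).
Local Notation mu := (@lebesgue_measure R).
Local Notation Om := (@Om R).

(** The two integrals agree with a test function in place of [g], and test functions approximate [g]
    in L^2. This is needed because the [psi] in [is_solution] is any weak derivative of [phi],
    whereas [inH10] approximates one of its own choosing. *)
Lemma weak_deriv_unique g phi psi1 psi2 : continuous g ->
  inL2 psi1 -> inL2 psi2 -> weak_deriv phi psi1 -> weak_deriv phi psi2 ->
  \int[mu]_(x in Om) (g x * psi1 x) = \int[mu]_(x in Om) (g x * psi2 x).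
Proof.
move=> cg L1 L2 w1 w2; have Lg := continuous_inL2 cg.
have [theta [ttheta theta_g]] := approximable_seq (approximable_continuous cg).
have Lth k := test_fun_inL2 (ttheta k).
have c1 := cvg_RintegralM L1 Lg Lth theta_g.
have c2 := cvg_RintegralM L2 Lg Lth theta_g.
have E : (fun k => \int[mu]_(x in Om) (psi1 x * theta k x)) =
         (fun k => \int[mu]_(x in Om) (psi2 x * theta k x)).
  by apply/funext => k; apply: oppr_inj; rewrite -w1// -w2.
rewrite E in c1; have {c1 c2} := cvg_unique _ c1 c2 => H.
have {}H := H (@norm_hausdorff _ _).
have sw (f h : R -> R) : \int[mu]_(x in Om) (f x * h x) =
    \int[mu]_(x in Om) (h x * f x).
  by apply: eq_Rintegral => x _; rewrite mulrC.
by rewrite sw H sw.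
Qed.

(** The identity defining the weak derivative [w] of [g] holds for the test functions approximating
    [phi]; both of its sides pass to the limit. *)
Lemma weak_deriv_inH10 g w phi psi : continuous g -> inL2 w -> weak_deriv g w ->
  inH10 phi -> inL2 psi -> weak_deriv phi psi ->
  \int[mu]_(x in Om) (g x * psi x) = - \int[mu]_(x in Om) (w x * phi x).
Proof.
move=> cg Lw wg [[Lphi _] [psi' [Lpsi' [wpsi' [phis [tphis [c1 c2]]]]]]] Lpsi wpsi.
have Lg := continuous_inL2 cg.
rewrite (weak_deriv_unique cg Lpsi Lpsi' wpsi wpsi').
have Lph k := test_fun_inL2 (tphis k).
have Lph' k := test_fun_derive1_inL2 (tphis k).
move: c1 => /(cvg_sqnorm (fun k => inL2B (Lph k) Lphi)).
move=> /(cvg_RintegralM Lw Lphi Lph) /cvgN c1.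
move: c2 => /(cvg_sqnorm (fun k => inL2B (Lph' k) Lpsi')).
move=> /(cvg_RintegralM Lg Lpsi' Lph').
under eq_fun do rewrite wg//.
by move=> c2; exact: (cvg_unique (@norm_hausdorff _ _) c2 c1).
Qed.

Lemma Rintegral_Om_split (f : R -> R) : mu.-integrable Om (EFin \o f) ->
  \int[mu]_(x in Om) f x = \int[mu]_(x in `]0, 1[) f x +
    (\int[mu]_(x in `]1, 2[) f x + \int[mu]_(x in `]2, 3[) f x).
Proof.
move=> fi; rewrite /Om (@Rintegral_itv_oo_split _ f 0 1 3) ?ltr1n//.
rewrite (@Rintegral_itv_oo_split _ f 1 2 3) ?ltr_nat ?ltr1n//.
apply: integrableS fi; [exact: measurable_itv|exact: measurable_itv|].
by apply: subset_itvr; rewrite bnd_simp.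
Qed.

Lemma indicM_inL2 (a b : R) (f : R -> R) : continuous f ->
  inL2 (fun x => \1_(`]a, b[ : set R) x * f x).
Proof.
move=> cf; have [M fM] := continuous_bounded_itv 0 3 cf.
apply: (@bounded_inL2 _ M).
  apply: measurable_funM; last exact: continuous_measurable_Om.
  by have [] := @indic_inL2 R `]a, b[ (measurable_itv _).
move=> x; rewrite /Om/= in_itv/= => /andP[x0 x3].
apply: le_trans (fM x _); last by rewrite !ltW.
by rewrite indicE; case: (_ \in _); rewrite ?mul1r ?mul0r ?normr0.
Qed.

Lemma indic_itv_oo (a b x : R) :
  \1_(`]a, b[ : set R) x = ((a < x) && (x < b))%:R :> R.
Proof. by rewrite indicE mem_setE in_itv. Qed.

(** The weak derivative of u' is its classical derivative on the three open intervals, because the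
    continuity of u' leaves no mass at 1 and 2. The weak equation is then integration by parts
    against H^1_0. *)
Lemma C1_is_solution u g lam : continuous g ->
  (forall x, is_derive x 1 u (g x)) -> u 0 = 0 -> u 3 = 0 ->
  (forall x, 0 < x < 1 -> is_derive x 1 g 0) ->
  (forall x, 1 < x < 2 -> is_derive x 1 g (- g x ^+ 2)) ->
  (forall x, 2 < x < 3 -> is_derive x 1 g (- lam * u x)) ->
  inH2 u /\ inH10 u /\ is_solution lam u.
Proof.
move=> cg du u0 u3 g1 g2 g3.
have cu : continuous u by move=> x; exact: is_derive_continuous (du x).
have Lu := continuous_inL2 cu; have Lg := continuous_inL2 cg.
have wug := C1_weak_deriv cg du; have uH10 := C1_inH10 cg du u0 u3.
have cg2 : continuous (fun x => - g x ^+ 2).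
  move=> x; apply: cvgN; under eq_fun do rewrite expr2; rewrite expr2.
  exact: (cvgM (cg x) (cg x)).
have clu : continuous (fun x => - lam * u x).
  by move=> x; apply: cvgM; [exact: cvg_cst|exact: cu].
pose w x := \1_(`]1, 2[ : set R) x * (- g x ^+ 2) +
            \1_(`]2, 3[ : set R) x * (- lam * u x).
have Lw : inL2 w by apply: inL2D; exact: indicM_inL2.
have wE1 x : 0 < x < 1 -> w x = 0.
  move=> /andP[x0 x1]; rewrite /w !indic_itv_oo [1 < x]ltNge ltW//=.
  by rewrite [2 < x]ltNge (le_trans (ltW x1))// ?mul0r ?addr0// ler1n.
have wE2 x : 1 < x < 2 -> w x = - g x ^+ 2.
  move=> /andP[x1 x2]; rewrite /w !indic_itv_oo x1 x2 [2 < x]ltNge ltW//=.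
  by rewrite mul1r mul0r addr0.
have wE3 x : 2 < x < 3 -> w x = - lam * u x.
  move=> /andP[x2 x3]; rewrite /w !indic_itv_oo x2 x3 [x < 2]ltNge ltW//=.
  by rewrite andbF mul1r mul0r add0r.
have wgw : weak_deriv g w.
  move=> phi tphi; have sphi := test_fun_smooth tphi.
  have Lphi := test_fun_inL2 tphi.
  rewrite !Rintegral_Om_split; last 2 first.
  - exact: inL2M.
  - by apply: inL2M => //; exact: test_fun_derive1_inL2.
  (* Of the boundary terms, those at 1 and 2 cancel between neighbouring intervals, and those at 0
     and 3 vanish with [phi]. *)
  rewrite (@Rintegral_by_parts _ g (cst 0) phi 0 1)//; last first.
    by move=> x; exact: cvg_cst.
  rewrite (@Rintegral_by_parts _ g (fun x => - g x ^+ 2) phi 1 2)// ?ltr1n//.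
  rewrite (@Rintegral_by_parts _ g (fun x => - lam * u x) phi 2 3)// ?ltr_nat//.
  rewrite (test_fun0 tphi) (test_fun3 tphi) !mulr0.
  have -> : \int[mu]_(x in `]0, 1[) (w x * phi x) =
      \int[mu]_(x in `]0, 1[) (cst 0 x * phi x).
    by apply: eq_Rintegral => x; rewrite inE/= in_itv/= => /wE1 ->.
  have -> : \int[mu]_(x in `]1, 2[) (w x * phi x) =
      \int[mu]_(x in `]1, 2[) (- g x ^+ 2 * phi x).
    by apply: eq_Rintegral => x; rewrite inE/= in_itv/= => /wE2 ->.
  have -> : \int[mu]_(x in `]2, 3[) (w x * phi x) =
      \int[mu]_(x in `]2, 3[) (- lam * u x * phi x).
    by apply: eq_Rintegral => x; rewrite inE/= in_itv/= => /wE3 ->.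
  ring.
split; last split => //.
  split => //; exists g; split=> //; split=> //.
  by split=> //; exists w.
split => //; split.
  split; first exact: continuous_measurable_Om.
  have [M uM] := continuous_bounded_itv 0 3 cu; exists M.
  apply: aeW => x; rewrite /Om/= in_itv/= => /andP[x0 x3].
  by apply: uM; rewrite !ltW.
exists g; split=> //; split=> //.
move=> phi psi Hphi _ Lpsi wpsi.
have Lphi : inL2 phi by case: Hphi => -[].
rewrite (weak_deriv_inH10 cg Lw wgw Hphi Lpsi wpsi).
have I1 := inL2M (indicM_inL2 1 2 cg2) Lphi.
have I2 := inL2M (indicM_inL2 2 3 cu) Lphi.
have -> : \int[mu]_(x in Om) (\1_(`]1, 2[ : set R) x * `|g x| ^+ 2 * phi x) =
    - \int[mu]_(x in Om) (\1_(`]1, 2[ : set R) x * (- g x ^+ 2) * phi x).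
  rewrite -mulN1r -RintegralZl//; apply: eq_Rintegral => x _.
  rewrite real_normK ?num_real//; ring.
have -> : \int[mu]_(x in Om) (w x * phi x) =
    \int[mu]_(x in Om) (\1_(`]1, 2[ : set R) x * (- g x ^+ 2) * phi x +
      (- lam) * (\1_(`]2, 3[ : set R) x * u x * phi x)).
  by apply: eq_Rintegral => x _; rewrite /w; ring.
rewrite RintegralD//; last exact: integrableZ_Om.
rewrite RintegralZl//; ring.
Qed.

End WeakSolutions.

(** * Gluing two functions at a point *)

Section Glue.
Context {R : realType}.
Implicit Types (f h : R -> R) (c d x : R).

Definition glue c f h x : R := if x <= c then f x else h x.

Lemma glue_lt c f h x : x < c -> \forall y \near x, f y = glue c f h y.
Proof.
by move=> xc; near=> y; rewrite /glue ifT// ltW//; near: y; exact: lt_nbhsl.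
Unshelve. all: by end_near. Qed.

Lemma glue_gt c f h x : c < x -> \forall y \near x, h y = glue c f h y.
Proof.
move=> cx; near=> y; rewrite /glue ifF//; apply/negbTE; rewrite -ltNge.
by near: y; exact: lt_nbhsr.
Unshelve. all: by end_near. Qed.

Lemma is_derive_glue_lt c f h x d :
  x < c -> is_derive x 1 f d -> is_derive x 1 (glue c f h) d.
Proof. by move=> xc; apply: near_eq_is_derive; exact: glue_lt. Qed.

Lemma is_derive_glue_gt c f h x d :
  c < x -> is_derive x 1 h d -> is_derive x 1 (glue c f h) d.
Proof. by move=> cx; apply: near_eq_is_derive; exact: glue_gt. Qed.

(** As [f] and [h] agree at [c], each difference quotient of the glued function there is one of [f]
    or one of [h], and both kinds tend to [d]. *)
Lemma is_derive_glue_at c f h d : f c = h c ->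
  is_derive c 1 f d -> is_derive c 1 h d -> is_derive c 1 (glue c f h) d.
Proof.
move=> fhc [df vf] [dh vh].
have cf : (fun t => t^-1 *: (f (t *: 1 + c) - f c)) @ (0 : R)^' --> d.
  by rewrite -vf; exact: df.
have ch : (fun t => t^-1 *: (h (t *: 1 + c) - h c)) @ (0 : R)^' --> d.
  by rewrite -vh; exact: dh.
have cg : (fun t => t^-1 *: (glue c f h (t *: 1 + c) - glue c f h c))
    @ (0 : R)^' --> d.
  move=> U /[dup] /cf Uf /ch Uh.
  change (\forall t \near (0 : R)^', U (t^-1 *:
    (glue c f h (t *: 1 + c) - glue c f h c))).
  have {}Uf : \forall t \near (0 : R)^', U (t^-1 *: (f (t *: 1 + c) - f c)) by [].
  have {}Uh : \forall t \near (0 : R)^', U (t^-1 *: (h (t *: 1 + c) - h c)) by [].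
  near=> t.
  have -> : glue c f h c = f c by rewrite /glue lexx.
  rewrite /glue; case: ifP => _; first by near: t.
  by rewrite fhc; near: t.
apply: DeriveDef; first by apply/cvg_ex; exists d.
exact: cvg_lim cg.
Unshelve. all: by end_near. Qed.

(** The derivative is again a [glue], so that the lemma nests for three pieces and [continuous_glue]
    applies to the result. *)
Lemma is_derive_glue c f h (f' h' : R -> R) :
  f c = h c -> f' c = h' c ->
  (forall x, x <= c -> is_derive x 1 f (f' x)) ->
  (forall x, c <= x -> is_derive x 1 h (h' x)) ->
  forall x, is_derive x 1 (glue c f h) (glue c f' h' x).
Proof.
move=> fhc fhc' df dh x; have [xc|cx|->] := ltgtP x c.
- rewrite {2}/glue (ltW xc).
  exact: is_derive_glue_lt xc (df x (ltW xc)).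
- rewrite {2}/glue leNgt cx/=.
  exact: is_derive_glue_gt cx (dh x (ltW cx)).
- rewrite {2}/glue lexx; apply: is_derive_glue_at => //; first exact: df.
  by rewrite fhc'; exact: dh.
Qed.

Lemma continuous_glue c f h : f c = h c ->
  (forall x, x <= c -> {for x, continuous f}) ->
  (forall x, c <= x -> {for x, continuous h}) -> continuous (glue c f h).
Proof.
move=> fhc cf ch x; have [xc|cx|xc] := ltgtP x c.
- apply: cvg_trans (_ : f y @[y --> x] --> _).
    exact: near_eq_cvg (glue_lt f h xc).
  by rewrite /glue (ltW xc); exact: cf (ltW xc).
- apply: cvg_trans (_ : h y @[y --> x] --> _).
    exact: near_eq_cvg (glue_gt f h cx).
  by rewrite /glue leNgt cx/=; exact: ch (ltW cx).
- have gc : glue c f h c = f c by rewrite /glue lexx.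
  rewrite xc /continuous_at gc => U Uf.
  have Uf' : \forall t \near c, U (f t) by exact: (cf c (lexx c)).
  rewrite fhc in Uf.
  have Uh' : \forall t \near c, U (h t) by exact: (ch c (lexx c)).
  change (\forall t \near c, U (glue c f h t)).
  by near=> t; rewrite /glue; case: ifP => _; near: t.
Unshelve. all: by end_near. Qed.

End Glue.

(** * The explicit solution and its size *)

Section ExplicitSolution.
Context {R : realType}.
Local Notation mu := (@lebesgue_measure R).
Context (s om A : R) (s0 : 0 < s).
(** These are the matching conditions at 2, for the value and for the slope. *)
Context (valueE : s + ln (1 + s) = A * sin om).
Context (slopeE : s / (1 + s) = - A * om * cos om).

Implicit Type x : R.

Lemma logarithm_arg_gt0 x : 1 <= x -> 0 < s * x + (1 - s).
Proof.
move=> x1; have -> : s * x + (1 - s) = 1 + s * (x - 1) by ring.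
by rewrite ltr_wpDr// mulr_ge0 ?subr_ge0// ltW.
Qed.

(* The arguments [1 + s (x - 1)] of the logarithm and [om (3 - x)] of the sine
   are written in the form [a * x + b] of [is_derive_comp_affine]. *)
Definition sol : R -> R :=
  glue 2 (glue 1 (fun x => s * x) (fun x => s + ln (s * x + (1 - s))))
         (fun x => A * sin (- om * x + 3 * om)).

Definition dsol : R -> R :=
  glue 2 (glue 1 (cst s) (fun x => s * (s * x + (1 - s))^-1))
         (fun x => (- A * om) * cos (- om * x + 3 * om)).

Lemma is_derive_log x : 1 <= x ->
  is_derive x 1 (fun x => s + ln (s * x + (1 - s))) (s * (s * x + (1 - s))^-1).
Proof.
move=> /logarithm_arg_gt0 dx; rewrite -[X in is_derive _ _ _ X]add0r.
apply: (@is_deriveD _ _ _ (cst s) (fun x => ln (s * x + (1 - s)))).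
by apply: is_derive_comp_affine; exact: is_derive1_ln.
Qed.

Lemma is_derive_log_slope x : 1 <= x ->
  is_derive x 1 (fun x => s * (s * x + (1 - s))^-1)
    (- (s * (s * x + (1 - s))^-1) ^+ 2).
Proof.
move=> /logarithm_arg_gt0 dx.
have dV : is_derive (s * x + (1 - s)) 1 (fun y : R => y^-1)
    (- (s * x + (1 - s)) ^- 2).
  apply: is_derive_eq; first by apply: is_deriveV; rewrite gt_eqF.
  by rewrite [_ *: 1]mulr1.
have := is_deriveZ s (is_derive_comp_affine dV).
move/is_derive_eq; apply; rewrite /GRing.scale/= exprMn -exprVn; ring.
Qed.

Lemma is_derive_sine x : is_derive x 1 (fun x => A * sin (- om * x + 3 * om))
  ((- A * om) * cos (- om * x + 3 * om)).
Proof.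
have := is_deriveZ A (is_derive_comp_affine (is_derive_sin (- om * x + 3 * om))).
by move/is_derive_eq; apply; rewrite /GRing.scale/=; ring.
Qed.

Lemma is_derive_cosine x :
  is_derive x 1 (fun x => (- A * om) * cos (- om * x + 3 * om))
    (- om ^+ 2 * (A * sin (- om * x + 3 * om))).
Proof.
have := is_deriveZ (- A * om)
  (is_derive_comp_affine (is_derive_cos (- om * x + 3 * om))).
by move/is_derive_eq; apply; rewrite /GRing.scale/=; ring.
Qed.

Lemma sol_glue1 : s * 1 = s + ln (s * 1 + (1 - s)).
Proof. by rewrite mulr1 subrKC ln1 addr0. Qed.

Lemma dsol_glue1 : s = s * (s * 1 + (1 - s))^-1.
Proof. by rewrite mulr1 subrKC invr1 mulr1. Qed.

Lemma sol_glue2 :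
  glue 1 (fun x => s * x) (fun x => s + ln (s * x + (1 - s))) 2 =
  A * sin (- om * 2 + 3 * om).
Proof.
rewrite /glue leNgt ltr1n/= (_ : s * 2 + (1 - s) = 1 + s); last by ring.
by rewrite valueE; congr (_ * sin _); ring.
Qed.

Lemma dsol_glue2 :
  glue 1 (cst s) (fun x => s * (s * x + (1 - s))^-1) 2 =
  (- A * om) * cos (- om * 2 + 3 * om).
Proof.
rewrite /glue leNgt ltr1n/= (_ : s * 2 + (1 - s) = 1 + s); last by ring.
by rewrite slopeE; congr (_ * cos _); ring.
Qed.

Lemma is_derive_sol x : is_derive x 1 sol (dsol x).
Proof.
apply: is_derive_glue => [||y _|y _].
- exact: sol_glue2.
- exact: dsol_glue2.
- apply: is_derive_glue => [||z _|z]; [exact: sol_glue1|exact: dsol_glue1| |].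
    by apply: is_derive_eq; rewrite /GRing.scale/= mulr1.
  exact: is_derive_log.
- exact: is_derive_sine.
Qed.

Lemma continuous_dsol : continuous dsol.
Proof.
apply: continuous_glue => [|y _|y _].
- exact: dsol_glue2.
- apply: continuous_glue => [|z _|z z1]; first exact: dsol_glue1.
    exact: cvg_cst.
  exact: is_derive_continuous (is_derive_log_slope z1).
- exact: is_derive_continuous (is_derive_cosine y).
Qed.

Lemma sol_is_solution : inH2 sol /\ inH10 sol /\ is_solution (om ^+ 2) sol.
Proof.
apply: (@C1_is_solution _ sol dsol).
- exact: continuous_dsol.
- exact: is_derive_sol.
- by rewrite /sol /glue ler0n ler01 mulr0.
- rewrite /sol /glue ler_nat/= (_ : - om * 3 + 3 * om = 0); last by ring.
  by rewrite sin0 mulr0.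
- move=> x /andP[x0 x1]; have x2 : x < 2 by rewrite (lt_trans x1)// ltr1n.
  exact: (is_derive_glue_lt _ x2 (is_derive_glue_lt _ x1 (is_derive_cst s x 1))).
- move=> x /andP[x1 x2].
  have -> : dsol x = s * (s * x + (1 - s))^-1.
    by rewrite /dsol /glue (ltW x2) leNgt x1.
  exact: (is_derive_glue_lt _ x2
           (is_derive_glue_gt _ x1 (is_derive_log_slope (ltW x1)))).
- move=> x /andP[x2 x3].
  have -> : sol x = A * sin (- om * x + 3 * om) by rewrite /sol /glue leNgt x2.
  exact: (is_derive_glue_gt _ x2 (is_derive_cosine x)).
Qed.

(** On (1/2, 1) the solution is s x > s / 2. An essential bound below s / 2 would make this
    interval, of measure 1/2, negligible. *)
Lemma Linf_norm_sol : ((s / 2)%:E <= Linf_norm sol)%E.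
Proof.
apply: le_ereal_inf_tmp => y /= [N [mN N0 subN]].
rewrite leNgt; apply/negP => ys.
pose I : set R := [set` `]2^-1, 1[%R].
have : (mu I <= mu N)%E.
  apply: le_measure; rewrite ?inE//; first exact: measurable_itv.
  move=> x; rewrite /I/= in_itv/= => /andP[x2 x1]; apply: subN => /=.
  apply/negP; rewrite -ltNge (lt_le_trans ys)// lee_fin.
  have x0 : 0 < x by rewrite (lt_trans _ x2)// invr_gt0.
  rewrite /Om indic_itv_oo x0 (lt_trans x1) ?ltr1n//= mul1r.
  rewrite /sol /glue (ltW x1) (ltW (lt_trans x1 _)) ?ltr1n//.
  by rewrite (le_trans _ (ler_norm _))// ler_pM2l// ltW.
rewrite /I lebesgue_measure_itv/= lte_fin N0 ifT; last by rewrite invf_lt1// ltr1n.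
by rewrite -EFinB lee_fin leNgt subr_gt0 invf_lt1// ltr1n.
Qed.

End ExplicitSolution.

(** * Existence of a matching frequency near pi / 2, and the theorem *)

Lemma matching_frequency (R : realType) (j : nat) : exists s om A : R,
  [/\ j.+1%:R <= s, pi / 2 <= om <= pi / 2 + j.+2%:R^-1,
      s + ln (1 + s) = A * sin om & s / (1 + s) = - A * om * cos om].
Proof.
pose e : R := j.+2%:R^-1; pose om0 := pi / 2 + e.
have e0 : 0 < e by rewrite invr_gt0.
have e1 : e < pi / 2.
  by rewrite (lt_le_trans _ (pihalf_ge1 R))// invf_lt1// ltr1n.
have pi0 : 0 < pi / 2 :> R by rewrite divr_gt0// pi_gt0.
have sin_e : 0 < sin e by rewrite sin_gt0_pihalf// e0 e1.
have om0_gt0 : 0 < om0 by rewrite addr_gt0.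
have q0 : 0 < om0 * sin e by rewrite mulr_gt0.
(* The first term forces growth with [j]; the second gives om0 * sin e * s >= 1, hence the sign of
   [f] at [om0] below. *)
pose s := j.+1%:R + (om0 * sin e)^-1.
have s0 : 0 < s by rewrite addr_gt0// invr_gt0.
pose B := s + ln (1 + s); pose C := s / (1 + s).
have s1 : 0 < 1 + s by rewrite addr_gt0.
have C0 : 0 < C by rewrite divr_gt0.
have C1 : C <= 1 by rewrite ler_pdivrMr //; lra.
have sB : s <= B by rewrite lerDl ln_ge0// lerDl ltW.
(* With [B] the value and [C] the slope at 2, this is the matching condition - om cot om = C / B
   cleared of denominators. At [om0] one has - cos om0 = sin e, so the first term is at least om0 *
   sin e * s >= 1, while the second is at most 1. *)
pose f (om : R) := - om * cos om * B - C * sin om.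
have cf : continuous f.
  move=> x; apply: cvgB; last first.
    by apply: cvgM; [exact: cvg_cst|exact: continuous_sin].
  apply: cvgM; last exact: cvg_cst.
  by apply: cvgM; [apply: cvgN; exact: cvg_id|exact: continuous_cos].
have f1 : f (pi / 2) <= 0.
  by rewrite /f cos_pihalf sin_pihalf mulr0 mul0r sub0r mulr1 oppr_le0 ltW.
have f2 : 0 <= f om0.
  rewrite /f /om0 [pi / 2 + e]addrC cosDpihalf sinDpihalf -/om0.
  rewrite [e + pi / 2]addrC -/om0 mulrNN subr_ge0.
  apply: (@le_trans _ _ 1).
    by rewrite (le_trans _ C1)// ler_piMr ?cos_le1// ltW.
  apply: (@le_trans _ _ (om0 * sin e * s)); last by rewrite ler_pM2l.
  by rewrite -ler_pdivrMl// mulr1 lerDr.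
have [om omI f0] : exists2 om, om \in `[pi / 2, om0] & f om = 0.
  apply: IVT; first by rewrite lerDl ltW.
    exact: continuous_subspaceT.
  by rewrite ge_min f1 le_max f2 orbT.
move: omI; rewrite in_itv/= => /andP[om1 om2].
have sin_om : 0 < sin om.
  apply: sin_gt0_pi; rewrite (lt_le_trans pi0)//=.
  by rewrite (le_lt_trans om2)// [ltRHS]splitr ltrD2l.
(* The value equation dictates [A]; the slope equation then amounts to f om = 0. *)
exists s, om, (B / sin om); split.
- by rewrite lerDl invr_ge0 ltW.
- by rewrite om1.
- by rewrite divfK ?gt_eqF.
- rewrite -/C; apply: (mulIf (lt0r_neq0 sin_om)).
  have {f0} /eqP := f0; rewrite /f subr_eq0 => /eqP <-.
  by field; rewrite gt_eqF.
Qed.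

Unset Implicit Arguments.

Theorem theorem2 (R : realType) :
  exists (lam : nat -> R) (u : nat -> R -> R),
    lam @ \oo --> (pi ^+ 2 / 4 : R) /\
    (forall j, inH2 (u j) /\ inH10 (u j) /\ is_solution (lam j) (u j)) /\
    (fun j => Linf_norm (u j)) @ \oo --> +oo%E.
Proof.
have [s /choice[om /choice[A H]]] := choice (@matching_frequency R).
have s0 j : 0 < s j by have [js _ _ _] := H j; exact: lt_le_trans js.
exists (fun j => om j ^+ 2), (fun j => sol (s j) (om j) (A j)); split; [|split].
- have om_cvg : om j @[j --> \oo] --> (pi / 2 : R).
    apply: (@squeeze_cvgr _ _ _ _ (fun=> pi / 2)
      (fun j => pi / 2 + (j.+2%:R : R)^-1)).
    + by apply: nearW => j; have [] := H j.
    + exact: cvg_cst.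
    + rewrite -[X in _ --> X]addr0; apply: cvgD; first exact: cvg_cst.
      (* The bound is the harmonic sequence 1 / (j + 1) shifted by one. *)
      rewrite (cvg_shiftS (fun j => (j.+1%:R : R)^-1)).
      exact: cvg_harmonic.
  have -> : pi ^+ 2 / 4 = pi / 2 * (pi / 2) :> R by field.
  by under eq_fun do rewrite expr2; exact: cvgM.
- by move=> j; have [_ _ vE dE] := H j; exact: sol_is_solution.
- apply/cvgeyPge => M; near=> j.
  apply: le_trans (@Linf_norm_sol R (s j) (om j) (A j) (s0 j)).
  have [js _ _ _] := H j; rewrite lee_fin ler_pdivlMr// (le_trans _ js)//.
  apply: (@le_trans _ _ j%:R); last by rewrite ler_nat.
  by near: j; exact: nbhs_infty_ger.
Unshelve. all: by end_near. Qed.
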